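(* Let $G$ be a finite simple undirected graph with $m$ edges in which every vertex has degree at least $2$, and let $\chi(u,0)=\det(\mathbf{T}+u\mathbf{J})=d_0u^{2m}+d_1u^{2m-1}+\cdots+d_{2m}$ be its reduced Bartholdi zeta function. Then for every integer $k$ with $1\le k\le 2m$, the coefficient $d_k$ of $u^{2m-k}$ is $$d_k=(-1)^m\sum_{i=1}^{p(k)}|\mathscr{U}_k^i|\cdot\det(\mathscr{P}_k^i),$$ where $p(k)$ is the number of unique partitions $\rho_k^1,\dots,\rho_k^{p(k)}$ of $k$, $\mathscr{U}_k^i$ is the collection of legal sets of sink star subgraphs of $\mathcal{D}(G)$ corresponding to $\rho_k^i$, and $\mathscr{P}_k^i$ is a prototype matrix of $\rho_k^i$.
   Context: Symmetric digraph: $\mathcal{D}(G)$ has vertex set $V(G)$ and arc set $\mathcal{E}(G)=\{(x,y),(y,x): xy\in E(G)\}$. For an arc $a=(x,y)$, $o(a)=x$, $t(a)=y$, $a^{-1}=(y,x)$. Orient the edges of $G$ arbitrarily and label the arcs $a_1,\dots,a_m,a_{1'},\dots,a_{m'}$ with $a_{i'}=a_i^{-1}$; put $(i')'=i$. All matrices are indexed by $1,\dots,m,1',\dots,m'$ in this order. Matrices ($2m\times 2m$): $\mathbf{T}_{ij}=1$ if $t(a_i)=o(a_j)$ and $a_j\ne a_i^{-1}$, and $0$ otherwise; $\mathbf{J}_{ij}=1$ if $a_j=a_i^{-1}$, and $0$ otherwise. Semi principal minor matrix: for $\alpha=\{i_1<\dots<i_q\}\subseteq\{1,\dots,m,1',\dots,m'\}$,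 $S[\alpha;\alpha']$ is the $q\times q$ submatrix of $\mathbf{T}$ whose rows are indexed by $i_1,\dots,i_q$ and whose columns are indexed, in this order, by $i_1',\dots,i_q'$. Unique partition: a unique partition of $k$ is a non-increasing sequence $c_1,\dots,c_l$ of integers greater than $1$ with $c_1+\dots+c_l=k$; $p(k)$ is the number of them, and they are listed as $\rho_k^1,\dots,\rho_k^{p(k)}$. Sink star subgraph with $q$ leaves ($q\ge2$): a subdigraph of $\mathcal{D}(G)$ consisting of a vertex $v$ (the sink node) together with $q$ distinct arcs of $\mathcal{D}(G)$ with terminus $v$ (and their origins, the leaves). A set of sink star subgraphs is legal if its members have pairwise distinct sink nodes. $\mathscr{U}_k^i$: if $\rho_k^i=(c_1,\dots,c_l)$, then $\mathscr{U}_k^i$ is the collection of all legal (unordered) sets of $l$ sink star subgraphs of $\mathcal{D}(G)$ whose numbers of leaves are, as a multiset, $c_1,\dots,c_l$; $|\mathscr{U}_k^i|$ is the number of such sets. Prototype matrix: to each legal set in $\mathscr{U}_k^i$ is associated the $k\times k$ matrix $S[\alpha;\alpha']$, where $\alpha$ is the set of labels of all the arcs of its stars. Two such matrices $A,B$ are called similar if $B=P^{-1}AP$ for a permutation matrix $P$. The matrices associated with the members of $\mathscr{U}_k^i$ are all similar in this sense, and $\mathscr{P}_k^i$ denotes any one of them. If $\mathscr{U}_k^i$ is empty, the corresponding term of the sum is $0$. *)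

(* Defs.v *)
From mathcomp Require Import all_boot all_order all_algebra.

Set Implicit Arguments.
Unset Strict Implicit.
Unset Printing Implicit Defensive.

Import GRing.Theory.

(* A finite simple graph is a symmetric irreflexive relation on a finType;
   an arc is an ordered pair (origin, terminus). *)

Section Graph.

Variables (V : finType) (e : rel V).

Definition edge_of (a : V * V) : {set V} := [set a.1; a.2].

Definition inv_arc (a : V * V) : V * V := (a.2, a.1).

Definition arcs : {set V * V} := [set a | e a.1 a.2].

Definition edges : {set {set V}} := [set edge_of a | a in arcs].

Definition degree (x : V) : nat := #|[set y | e x y]|.

(* [a] orients and numbers the edges: i |-> the i-th edge is a bijection from
   'I_m onto the edge set, and [a i] is one of the two arcs on that edge. *)
Definition orientation m (a : 'I_m -> V * V) : Prop :=
  injective (fun i => edge_of (a i)) /\ [set edge_of (a i) | i : 'I_m] = edges.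

End Graph.

(* The labels 1, .., m, 1', .., m' are the elements of 'I_(m + m), in order;
   [inv_label i] is i'. *)
Definition inv_label m (i : 'I_(m + m)) : 'I_(m + m) :=
  match split i with inl j => rshift m j | inr j => lshift m j end.

Definition arc (V : finType) m (a : 'I_m -> V * V) (i : 'I_(m + m)) : V * V :=
  match split i with inl j => a j | inr j => inv_arc (a j) end.

Section Matrices.

Local Open Scope ring_scope.

Variables (V : finType) (m : nat) (a : 'I_m -> V * V).

Definition Tmx : 'M[int]_(m + m) :=
  \matrix_(i, j) (((arc a i).2 == (arc a j).1)
                    && (arc a j != inv_arc (arc a i)))%:R.

Definition Jmx : 'M[int]_(m + m) :=
  \matrix_(i, j) (arc a j == inv_arc (arc a i))%:R.

(* chi(u, 0), with u the polynomial variable. *)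
Definition reduced_bartholdi : {poly int} :=
  \det (map_mx polyC Tmx + 'X *: map_mx polyC Jmx).

(* S[alpha; alpha']: [enum_val] lists alpha in increasing order, and the
   columns are taken in the order induced from that of the rows. *)
Definition semi_principal_minor (alpha : {set 'I_(m + m)}) : 'M[int]_#|alpha| :=
  mxsub (fun i => enum_val i) (fun j => inv_label (enum_val j)) Tmx.

End Matrices.

Definition unique_partition (k : nat) (c : seq nat) : bool :=
  [&& sorted geq c, all (fun x => 1 < x) c & sumn c == k].

(* A unique partition of k has at most k parts, each at most k; see
   [mem_unique_partitions] and [uniq_unique_partitions]. *)
Definition unique_partitions (k : nat) : seq (seq nat) :=
  undup [seq c <- flatten [seq [seq map val (val t) | t : n.-tuple 'I_k.+1]
                          | n <- iota 0 k.+1]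
        | unique_partition k c].

Definition num_unique_partitions (k : nat) : nat := size (unique_partitions k).

Definition rho (k : nat) (i : 'I_(num_unique_partitions k)) : seq nat :=
  nth [::] (unique_partitions k) i.

Section Stars.

Variables (V : finType) (e : rel V).

(* A sink star is given by its sink and its set of arcs, the leaves being the
   origins of the arcs. *)
Definition star : Type := (V * {set V * V})%type.

Definition leaves (s : star) : nat := #|s.2|.

Definition sink_star (s : star) : bool :=
  [&& 2 <= leaves s, s.2 \subset arcs e & [forall a in s.2, a.2 == s.1]].

Definition legal (L : {set star}) : bool :=
  [forall s in L, sink_star s]
  && [forall s in L, forall t in L, (s.1 == t.1) ==> (s == t)].

Definition legal_sets (c : seq nat) : {set {set star}} :=
  [set L | legal L && perm_eq [seq leaves s | s <- enum L] c].

Definition star_labels m (a : 'I_m -> V * V) (L : {set star}) :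
    {set 'I_(m + m)} :=
  [set i | [exists s in L, arc a i \in s.2]].

(* The cast along #|star_labels a L| = k is always available when L is in
   [legal_sets c] and sumn c = k; see [card_star_labels]. *)
Definition prototype m (a : 'I_m -> V * V) k (c : seq nat)
    (A : 'M[int]_k) : Prop :=
  exists2 L : {set star}, L \in legal_sets c &
  exists h : #|star_labels a L| = k,
    A = castmx (h, h) (semi_principal_minor a (star_labels a L)).

End Stars.

Lemma mem_unique_partitions k c :
  (c \in unique_partitions k) = unique_partition k c.
Proof.
rewrite mem_undup mem_filter andb_idr // => /and3P[_ c1 /eqP ck].
have szc : size c <= sumn c.
  elim: c c1 {ck} => //= x c IH /andP[x1 /IH szc].
  by rewrite -add1n leq_add // ltnW.
have lec : all (fun x => x < k.+1) c.
  rewrite -ck; apply/allP => x; elim: c {c1 ck szc} => //= y c IH.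
  rewrite inE ltnS => /orP[/eqP->|/IH]; first exact: leq_addr.
  by rewrite ltnS => /leq_trans-> //; apply: leq_addl.
apply/flatten_mapP; exists (size c).
  by rewrite mem_iota /= add0n ltnS -ck.
have szt : size (map (@inord k) c) == size c by rewrite size_map.
apply/imageP; exists (Tuple szt) => //=.
rewrite -map_comp -[LHS]map_id; apply/eq_in_map => x xc /=.
by rewrite inordK //; move/allP: lec => /(_ x xc).
Qed.

Lemma uniq_unique_partitions k : uniq (unique_partitions k).
Proof. exact: undup_uniq. Qed.

Lemma arc_inj (V : finType) (e : rel V) m (a : 'I_m -> V * V) :
  irreflexive e -> orientation e a -> injective (arc a).
Proof.
move=> eI [aI aE].
have nl j : (a j).1 != (a j).2.
  have : edge_of (a j) \in edges e by rewrite -aE; apply: imset_f.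
  case/imsetP => -[x y]; rewrite inE /edge_of /= => exy E.
  apply/eqP => xx; move: E; rewrite xx setUid => E.
  have : x \in [set (a j).2] by rewrite E !inE eqxx.
  have : y \in [set (a j).2] by rewrite E !inE eqxx orbT.
  by rewrite !inE => /eqP yE /eqP xE; rewrite xE yE eI in exy.
have eV b : edge_of (inv_arc b) = edge_of b by rewrite /edge_of /= setUC.
have neV j : a j <> inv_arc (a j).
  by move=> E; move: (nl j); rewrite {1}E eqxx.
move=> i j; rewrite /arc -{2}(splitK i) -{2}(splitK j).
case: (split i) => i1; case: (split j) => j1 /= E.
- by rewrite (aI i1 j1) //= E.
- have ij : i1 = j1 by apply: aI; rewrite /= E eV.
  by subst j1; case: (neV i1).
- have ij : i1 = j1 by apply: aI; rewrite /= -E eV.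
  by subst j1; case: (neV i1).
- by rewrite (aI i1 j1) //= -eV E eV.
Qed.

Lemma arc_onto (V : finType) (e : rel V) m (a : 'I_m -> V * V) b :
  orientation e a -> b \in arcs e -> exists i, arc a i = b.
Proof.
move=> [_ aE] be.
have : edge_of b \in edges e by apply: imset_f.
rewrite -aE => /imsetP[j _ /setP E].
have := E b.1; have := E b.2; have := E (a j).1; have := E (a j).2.
rewrite !inE !eqxx !orbT /= => H1 H2 /esym H3 /esym H4.
have : b = a j \/ b = inv_arc (a j).
  move: H1 H2 H3 H4; rewrite /inv_arc; case: b {be E} (a j) => [x y] [z t] /=.
  by do 4!(case/orP => /eqP ?); subst; auto.
case=> ->.
  by exists (lshift m j); rewrite /arc (unsplitK (inl _ j)).
by exists (rshift m j); rewrite /arc (unsplitK (inr _ j)).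
Qed.

Lemma card_star_labels (V : finType) (e : rel V) m (a : 'I_m -> V * V) c L :
  irreflexive e -> orientation e a -> L \in legal_sets e c ->
  #|star_labels a L| = sumn c.
Proof.
move=> eI aO; rewrite inE => /andP[/andP[/forall_inP Ls /forall_inP Ld] Lc].
have sink s b : s \in L -> b \in s.2 -> b.2 = s.1.
  by move=> /Ls/and3P[_ _ /forall_inP sb] /sb/eqP.
rewrite -(perm_sumn Lc) sumnE big_map big_enum /=.
rewrite -(card_imset _ (arc_inj eI aO)).
have -> : arc a @: star_labels a L = \bigcup_(s in L) s.2.
  apply/setP => b; apply/imsetP/bigcupP => [[i]|[s sL bs]].
    by rewrite inE => /exists_inP[s sL ias] ->; exists s.
  have /and3P[_ /subsetP/(_ b bs) be _] := Ls s sL.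
  have [i ib] := arc_onto aO be; exists i => //.
  by rewrite inE; apply/exists_inP; exists s; rewrite ?ib.
have sink_eq s t b : s \in L -> t \in L -> b \in s.2 -> b \in t.2 -> s = t.
  move=> sL tL bs bt; apply/eqP; apply: (implyP (forall_inP (Ld s sL) t tL)).
  by rewrite -(sink s b) // (sink t b).
have snd_inj : {in L &, injective snd}.
  move=> s t sL tL st; have /and3P[s2 _ _] := Ls s sL.
  have /card_gt0P[b bs] : 0 < #|s.2| by apply: ltnW.
  by apply: (sink_eq s t b) => //; rewrite -st.
rewrite -cover_imset -(big_imset (fun A : {set V * V} => #|A|) snd_inj).
apply/esym/eqP/trivIsetP => _ _ /imsetP[s sL ->] /imsetP[t tL ->] st.
rewrite -setI_eq0; apply/set0Pn => -[b]; rewrite inE => /andP[bs bt].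
by rewrite (sink_eq s t b) ?eqxx in st.
Qed.

(* Main.v *)
From mathcomp Require Import all_boot all_order all_algebra all_fingroup.
Require Import Defs.

(** The idea is that right multiplication by J, which only renames columns by
    the involution i |-> i', turns the problem into one about principal minors.
    Since J is an involution, T + u J = (T J + u I) J, and J has determinant
    (-1)^m ([reduced_bartholdiE]). Hence d_k is (-1)^m times the sum of the
    k x k principal minors of T J ([coef_det_addX_minors]); these are the
    determinants of the semi principal minor matrices
    ([semi_principal_minorE]).

    The entry of T J at (i, j) is 1 exactly when a_i and a_j are distinct arcs
    with the same terminus. So T J is block diagonal, with one block per vertex,
    and each block is the all-ones matrix minus the identity. A principal minor
    on a set S of labels is therefore a product over the vertices v of a factor
    depending only on the number of arcs of S ending at v
    ([det_same_head_minor]). The factor of a single arc is the determinant of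
    the 1 x 1 zero matrix, so S contributes only if no vertex receives exactly
    one of its arcs. Grouping the arcs of such an S by terminus gives a legal
    set of sink stars, and this is a bijection ([star_labelsK], [stars_ofK]);
    the minor depends only on the numbers of leaves ([det_prototype]).
    Collecting the legal sets by the partition formed by their numbers of
    leaves ([sum_legal_sets]) gives the formula. *)

Set Implicit Arguments.
Unset Strict Implicit.
Unset Printing Implicit Defensive.

Import GRing.Theory.

Local Open Scope ring_scope.

(** * Principal minors and the determinant of A + X I *)

Section PrincipalMinors.

Variables (R : comNzRingType) (n : nat).
Implicit Types (A : 'M[R]_n) (S : {set 'I_n}).

Definition principal_submx A S : 'M[R]_#|S| :=
  mxsub (fun i => enum_val i) (fun j => enum_val j) A.

(** A matrix of fixed size with the same determinant as the principal
    submatrix on S. With it minors on different sets can be multiplied and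
    compared without changing dimension. *)
Definition pad_mx A S : 'M[R]_n :=
  \matrix_(i, j) (if i \in S then A i j else (i == j)%:R).

Lemma det_mxsub_bij p (f : 'I_p -> 'I_n) A :
  bijective f -> \det (mxsub f f A) = \det A.
Proof.
move=> f_bij; have := bij_eq_card f_bij; rewrite !card_ord => pn.
case: n / pn in A f f_bij *.
have f_inj := bij_inj f_bij.
have -> : mxsub f f A = row_perm (perm f_inj) (col_perm (perm f_inj) A).
  by apply/matrixP => i j; rewrite !mxE !permE.
rewrite row_permE col_permE !det_mulmx mulrCA !det_perm odd_permV.
by rewrite -signr_addb addbb mulr1.
Qed.

(** Listing the elements of S before the others makes the padded matrix block
    upper triangular, with an identity block in the lower right corner. *)
Lemma det_pad_mx A S : \det (pad_mx A S) = \det (principal_submx A S).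
Proof.
pose f (i : 'I_(#|S| + #|~: S|)) : 'I_n :=
  match split i with inl j => enum_val j | inr j => enum_val j end.
have fl j : f (lshift _ j) = enum_val j by rewrite /f (unsplitK (inl j)).
have fr j : f (rshift _ j) = enum_val j by rewrite /f (unsplitK (inr j)).
have frS j : (f (rshift _ j) \in S) = false.
  by rewrite fr; apply/negbTE; rewrite -in_setC; apply: enum_valP.
have flS j : f (lshift _ j) \in S by rewrite fl; apply: enum_valP.
have f_inj : injective f.
  move=> i j; case: (split_ordP i) => i1 ->; case: (split_ordP j) => j1 -> E.
  - by move: E; rewrite !fl => /enum_val_inj->.
  - by move: (flS i1); rewrite E frS.
  - by move: (flS j1); rewrite -E frS.
  - by move: E; rewrite !fr => /enum_val_inj->.
have f_bij : bijective f.
  by apply: inj_card_bij => //; rewrite !card_ord cardsC card_ord.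
rewrite -(det_mxsub_bij _ f_bij) -[mxsub f f _]submxK.
set M := mxsub f f _.
have -> : dlsubmx M = 0.
  apply/matrixP => i j; rewrite !mxE frS (inj_eq f_inj).
  by rewrite eq_rlshift.
have -> : drsubmx M = 1%:M.
  by apply/matrixP => i j; rewrite !mxE frS (inj_eq f_inj) eq_rshift.
rewrite det_ublock det1 mulr1; congr (\det _).
by apply/matrixP => i j; rewrite !mxE flS !fl.
Qed.

(** In the Leibniz formula, expanding each product of sums chooses the set S of
    rows from which the entry of A is taken. The other rows contribute X on the
    diagonal and 0 elsewhere, so the terms with a given S add up to the
    determinant of the matrix padded outside S, times a power of X. *)
Lemma det_addX_minors A :
  \det (map_mx polyC A + 'X%:M) =
    \sum_(S : {set 'I_n}) (\det (principal_submx A S))%:P * 'X^(n - #|S|).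
Proof.
under [RHS]eq_bigr do rewrite -det_pad_mx rmorph_sum mulr_suml.
rewrite exchange_big; apply: eq_bigr => s _ /=.
under eq_bigr do rewrite !mxE.
rewrite bigA_distr mulr_sumr; apply: eq_bigr => S _.
rewrite rmorphM rmorph_sign -mulrA; congr (_ * _).
have -> : (n - #|S|)%N = #|~: S|.
  by rewrite -[X in (X - _)%N]card_ord -(cardsC S) addKn.
rewrite rmorph_prod -prodr_const [\prod_(i in _) _]big_mkcond -big_split.
apply: eq_bigr => i _ /=; rewrite mxE inE.
case: ifP => _ /=; first by rewrite mulr1.
by rewrite rmorph_nat mulrC mulr_natr.
Qed.

Lemma coef_det_addX_minors A k : (k <= n)%N ->
  (\det (map_mx polyC A + 'X%:M))`_(n - k) =
    \sum_(S : {set 'I_n} | #|S| == k) \det (principal_submx A S).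
Proof.
move=> kn; rewrite det_addX_minors coef_sum [RHS]big_mkcond.
apply: eq_bigr => S _; rewrite coefCM coefXn.
have Sn : (#|S| <= n)%N by rewrite -[X in (_ <= X)%N]card_ord max_card.
have -> : (n - k == n - #|S|)%N = (#|S| == k).
  by apply/eqP/eqP => [E|->//]; rewrite -(subKn kn) E subKn.
by case: eqP => _; rewrite ?mulr1 ?mulr0.
Qed.

(** A row of A indexed by S1 vanishes in the columns of S2, so in the product it
    meets only the identity rows of the right factor and is left unchanged. *)
Lemma pad_mxU A S1 S2 : {in S1 & S2, forall i j, A i j = 0} ->
  pad_mx A (S1 :|: S2) = pad_mx A S1 *m pad_mx A S2.
Proof.
move=> A0; apply/matrixP => i j; rewrite !mxE inE.
have [iS1|iS1] /= := boolP (i \in S1); last first.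
  rewrite (bigD1 i) //= big1 ?addr0 => [|l li].
    by rewrite !mxE (negbTE iS1) eqxx mul1r.
  by rewrite !mxE (negbTE iS1) eq_sym (negbTE li) mul0r.
rewrite (bigD1 j) //= big1 ?addr0 => [|l lj].
  by rewrite !mxE iS1; case: ifP => jS2; rewrite ?eqxx ?mulr1 // A0 ?mul0r.
rewrite !mxE iS1; case: ifP => lS2; first by rewrite A0 ?mul0r.
by rewrite (negbTE lj) mulr0.
Qed.

(** A vanishes off the diagonal blocks cut out by the fibers of t, so a
    principal minor splits along them. *)
Lemma det_principal_submx_fibers (T : finType) (t : 'I_n -> T) A S :
  (forall i j, t i != t j -> A i j = 0) ->
  \det (principal_submx A S) =
    \prod_x \det (principal_submx A [set i in S | t i == x]).
Proof.
move=> A0; under eq_bigr do rewrite -det_pad_mx.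
rewrite -det_pad_mx -big_enum /=.
have {1}-> : S = [set i in S | t i \in enum T].
  by apply/setP => i; rewrite inE mem_enum andbT.
(* The fibers are split off one at a time: the induction is on a
   duplicate-free list of values of t, the padded set being the part of S
   whose t-value is in the list. *)
elim: (enum T) (enum_uniq T) => [_|x r IH /= /andP[xr /IH{}IH]].
  rewrite big_nil -[RHS](det1 _ n); congr (\det _).
  by apply/matrixP => i j; rewrite !mxE inE andbF.
rewrite big_cons -IH -det_mulmx -pad_mxU => [|i j].
  by congr (\det (pad_mx A _)); apply/setP => i; rewrite !inE andb_orr.
rewrite !inE => /andP[_ /eqP tix] /andP[_ tjr].
by apply: A0; apply: contraNneq xr; rewrite -tix => ->.
Qed.

End PrincipalMinors.

(** * The arc reversal matrix *)

Section Labels.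

Variable m : nat.

Lemma inv_labelK : involutive (@inv_label m).
Proof.
move=> i; rewrite -{2}(splitK i) /inv_label.
by case: (split i) => j /=; rewrite ?(unsplitK (inl j)) ?(unsplitK (inr j)).
Qed.

Definition flip_mx : 'M[int]_(m + m) := \matrix_(i, j) (j == inv_label i)%:R.

Lemma mulmx_flip (R : pzRingType) (B : 'M[R]_(m + m)) i j :
  (B *m map_mx intr flip_mx) i j = B i (inv_label j).
Proof.
rewrite mxE (bigD1 (inv_label j)) //= big1 => [|l lj]; rewrite !mxE.
  by rewrite inv_labelK eqxx mulr1 addr0.
rewrite (_ : (j == _) = false) ?mulr0 //; apply: contraNF lj => /eqP->.
by rewrite inv_labelK.
Qed.

(** The sign of the permutation exchanging two halves of length m, read off a
    factorization into block triangular matrices rather than from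
    transpositions. *)
Lemma det_flip_mx : \det flip_mx = (-1) ^+ m.
Proof.
have -> : flip_mx = block_mx 0 1%:M 1%:M 0.
  apply/matrixP => i j; rewrite mxE.
  case: (split_ordP i) => i1 ->; case: (split_ordP j) => j1 ->;
    rewrite ?block_mxEul ?block_mxEur ?block_mxEdl ?block_mxEdr !mxE;
    rewrite /inv_label ?(unsplitK (inl i1)) ?(unsplitK (inr i1));
    by rewrite ?eq_lrshift ?eq_rlshift ?eq_lshift ?eq_rshift // eq_sym.
have E : block_mx 0 1%:M 1%:M 0 *m block_mx 1%:M 0 1%:M 1%:M
       = block_mx 1%:M 0 1%:M 1%:M *m block_mx 1%:M 1%:M 0 (- 1%:M)
         :> 'M[int]_(m + m).
  by rewrite !mulmx_block !mulmx1 !mul0mx !mulmx0 !mul1mx !add0r !addr0 subrr.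
have := congr1 determinant E; rewrite !det_mulmx det_lblock det_ublock !det1.
by rewrite !mulr1 !mul1r -scaleN1r detZ det1 mulr1.
Qed.

End Labels.

(** The all-ones matrix minus the identity: the block of T J at a vertex
    receiving q of the chosen arcs. *)
Definition neq_mx q : 'M[int]_q := \matrix_(i, j) (i != j)%:R.

Lemma det_neq_mx0 : \det (neq_mx 0) = 1.
Proof. exact: det_mx00. Qed.

Lemma det_neq_mx1 : \det (neq_mx 1) = 0.
Proof. by rewrite det_mx11 mxE eqxx. Qed.

(** * The matrix T J and its principal minors *)

Section Bartholdi.

Variables (V : finType) (e : rel V) (m : nat) (a : 'I_m -> V * V).
Hypotheses (e_sym : symmetric e) (e_irr : irreflexive e).
Hypothesis a_orient : orientation e a.

Let arc_inj := arc_inj e_irr a_orient.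

Lemma arc_inv_label i : arc a (inv_label i) = inv_arc (arc a i).
Proof.
rewrite /arc /inv_label; case: (split i) => j.
  by rewrite (unsplitK (inr j)).
by rewrite (unsplitK (inl j)) /inv_arc /=; case: (a j).
Qed.

Lemma arc_in_arcs i : arc a i \in arcs e.
Proof.
have a_arc j : a j \in arcs e.
  have : edge_of (a j) \in edges e by rewrite -a_orient.2; apply: imset_f.
  case/imsetP => b; rewrite !inE => eb /setP E.
  have := E b.1; have := E b.2; have := E (a j).1; have := E (a j).2.
  rewrite !inE !eqxx !orbT /= => /esym H1 /esym H2 H3 H4.
  move: H1 H2 H3 H4 eb; case: b {E} (a j) => [x y] [z t] /=.
  by do 4!(case/orP => /eqP ?); subst; rewrite // e_sym.
rewrite /arc; case: (split i) => j //.
by have := a_arc j; rewrite !inE /= e_sym.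
Qed.

(** This is T J, with T_(i, j') read as: a_i and a_j end at the same vertex
    and differ. *)
Definition same_head_mx : 'M[int]_(m + m) :=
  \matrix_(i, j) (((arc a i).2 == (arc a j).2) && (i != j))%:R.

Lemma Tmx_same_head i j : Tmx a i j = same_head_mx i (inv_label j).
Proof.
rewrite !mxE arc_inv_label /=; congr (_ && ~~ _)%:R.
by rewrite -arc_inv_label (inj_eq arc_inj) eq_sym (inv_eq (@inv_labelK m)).
Qed.

Lemma semi_principal_minorE S :
  semi_principal_minor a S = principal_submx same_head_mx S.
Proof.
by apply/matrixP => i j; rewrite mxE Tmx_same_head inv_labelK [RHS]mxE.
Qed.

Lemma reduced_bartholdiE :
  reduced_bartholdi a =
    (-1) ^+ m * \det (map_mx polyC same_head_mx + 'X%:M).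
Proof.
have -> : reduced_bartholdi a =
  \det ((map_mx polyC same_head_mx + 'X%:M) *m map_mx intr (flip_mx m)).
  congr (\det _); apply/matrixP => i j; rewrite mulmx_flip.
  rewrite 2!mxE Tmx_same_head [in RHS]mxE !mxE; congr (_ + _).
  rewrite -arc_inv_label (inj_eq arc_inj) eq_sym (inv_eq (@inv_labelK m)).
  by case: eqP => _; rewrite ?mulr1 ?mulr0.
by rewrite det_mulmx mulrC det_map_mx det_flip_mx rmorph_sign.
Qed.

(** * Sink stars and sets of labels *)

Definition labels_into (S : {set 'I_(m + m)}) v :=
  [set i in S | (arc a i).2 == v].

Definition stars_of (S : {set 'I_(m + m)}) : {set star V} :=
  [set (v, arc a @: labels_into S v) | v in V & labels_into S v != set0].

Lemma det_same_head_minor S :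
  \det (principal_submx same_head_mx S) =
    \prod_v \det (neq_mx #|labels_into S v|).
Proof.
rewrite (@det_principal_submx_fibers _ _ _ (fun i => (arc a i).2)).
  apply: eq_bigr => v _; congr (\det _); apply/matrixP => i j; rewrite !mxE.
  have /setIdP[_ /eqP->] := enum_valP i; have /setIdP[_ /eqP->] := enum_valP j.
  by rewrite eqxx (inj_eq enum_val_inj).
by move=> i j ij; rewrite mxE (negbTE ij).
Qed.

(** Vertices receiving no arc of S are not sinks of [stars_of S]; they can be
    dropped because the empty determinant is 1. *)
Lemma det_same_head_minor_stars S :
  \det (principal_submx same_head_mx S) =
    \prod_(s in stars_of S) \det (neq_mx (leaves s)).
Proof.
rewrite det_same_head_minor big_imset => [|v w _ _ []//] /=.
rewrite [RHS]big_mkcond; apply: eq_bigr => v _.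
rewrite inE.
have [E|_] /= := eqVneq (labels_into S v) set0.
  by rewrite E cards0 det_neq_mx0.
by rewrite /leaves card_imset.
Qed.

(** Every part of a unique partition exceeds 1, so these are the label sets that
    can come from sink stars. *)
Definition singleton_free S := [forall v, #|labels_into S v| != 1%N].

Lemma det_same_head_minor_eq0 S :
  ~~ singleton_free S -> \det (principal_submx same_head_mx S) = 0.
Proof.
case/forallPn => v /negPn/eqP v1; rewrite det_same_head_minor (bigD1 v) //=.
by rewrite v1 det_neq_mx1 mul0r.
Qed.

Lemma stars_of_legal S : singleton_free S -> legal e (stars_of S).
Proof.
move=> /forallP S1; apply/andP; split.
  apply/forall_inP => _ /imsetP[v /setIdP[_ v0] ->].
  apply/and3P; split => /=.
  - rewrite /leaves card_imset //= ltn_neqAle eq_sym S1 /=.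
    by rewrite card_gt0.
  - by apply/subsetP => _ /imsetP[i _ ->]; apply: arc_in_arcs.
  - by apply/forall_inP => _ /imsetP[i /setIdP[_ ?] ->].
apply/forall_inP => _ /imsetP[v _ ->]; apply/forall_inP => _ /imsetP[w _ ->].
by apply/implyP => /= /eqP->.
Qed.

Lemma star_labelsK S : star_labels a (stars_of S) = S.
Proof.
apply/setP => i; rewrite inE; apply/exists_inP/idP => [[s]|iS].
  by case/imsetP => v _ -> /=; rewrite mem_imset // => /setIdP[].
have iv : i \in labels_into S (arc a i).2 by rewrite inE iS eqxx.
exists ((arc a i).2, arc a @: labels_into S (arc a i).2).
  apply/imsetP; exists (arc a i).2 => //; rewrite inE.
  by apply/set0Pn; exists i.
by rewrite mem_imset.
Qed.

Section Legal.

Variable L : {set star V}.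
Hypothesis L_legal : legal e L.

Lemma legal_sink s b : s \in L -> b \in s.2 -> b.2 = s.1.
Proof.
case/andP: L_legal => /forall_inP Ls _ /Ls/and3P[_ _ /forall_inP sb].
by move/sb/eqP.
Qed.

Lemma legal_inj s t : s \in L -> t \in L -> s.1 = t.1 -> s = t.
Proof.
case/andP: L_legal => _ /forall_inP Ld sL tL /eqP st; apply/eqP.
exact: implyP (forall_inP (Ld s sL) t tL) st.
Qed.

Lemma labels_into_star_labels s :
  s \in L -> arc a @: labels_into (star_labels a L) s.1 = s.2.
Proof.
move=> sL; apply/setP => b; apply/imsetP/idP => [[i]|bs].
  rewrite !inE => /andP[/exists_inP[t tL iat] /eqP is1] ->.
  by rewrite -(@legal_inj t s) // -is1 (legal_sink tL iat).
case/andP: L_legal => /forall_inP/(_ s sL)/and3P[_ /subsetP sA _] _.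
have [i ib] := arc_onto a_orient (sA b bs); exists i => //.
rewrite !inE ib (legal_sink sL bs) eqxx andbT.
by apply/exists_inP; exists s; rewrite ?ib.
Qed.

Lemma stars_ofK : stars_of (star_labels a L) = L.
Proof.
apply/setP => s; apply/imsetP/idP => [[v /setIdP[_ /set0Pn[i iv]] ->]|sL].
  have /setIdP[] := iv; rewrite inE => /exists_inP[t tL iat] /eqP.
  rewrite (legal_sink tL iat) => <-.
  by rewrite labels_into_star_labels -?surjective_pairing.
exists s.1; rewrite ?labels_into_star_labels -?surjective_pairing // inE /=.
rewrite -(imset_eq0 (arc a)) labels_into_star_labels //.
case/andP: L_legal => /forall_inP/(_ s sL)/and3P[s2 _ _] _.
by rewrite -card_gt0; apply: ltnW.
Qed.

Lemma star_labels_singleton_free : singleton_free (star_labels a L).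
Proof.
apply/forallP => v; apply/negP => v1.
have vL : (v, arc a @: labels_into (star_labels a L) v) \in L.
  rewrite -{2}stars_ofK; apply/imsetP; exists v => //.
  by rewrite inE -card_gt0 (eqP v1).
case/andP: L_legal => /forall_inP/(_ _ vL)/and3P[].
by rewrite /leaves card_imset // (eqP v1).
Qed.

End Legal.

(** All matrices attached to the partition c have the same determinant, since
    the minor is a product over the stars of factors depending only on their
    numbers of leaves, which are the parts of c. *)
Lemma det_prototype k c (A : 'M[int]_k) L :
  prototype e a c A -> L \in legal_sets e c ->
  \det (principal_submx same_head_mx (star_labels a L)) = \det A.
Proof.
have minor_c L' : L' \in legal_sets e c ->
    \det (principal_submx same_head_mx (star_labels a L')) =
      \prod_(x <- c) \det (neq_mx x).
  rewrite inE => /andP[L'_legal L'c].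
  rewrite det_same_head_minor_stars stars_ofK //.
  by rewrite -(perm_big _ L'c) big_map big_enum.
case=> L' L'c [h defA] Lc; rewrite defA (minor_c L) // -(minor_c L') //.
by case: k / h A {defA} => _; rewrite castmx_id semi_principal_minorE.
Qed.

(** A legal set lies in the collection of exactly one unique partition, the
    non-increasing rearrangement of its numbers of leaves; that partition is one
    of k exactly when the stars have k arcs altogether. *)
Lemma sum_legal_sets k (F : {set star V} -> int) :
  \sum_(i < num_unique_partitions k) \sum_(L in legal_sets e (rho i)) F L =
    \sum_(L | legal e L && (#|star_labels a L| == k)) F L.
Proof.
transitivity (\sum_(c <- unique_partitions k)
                \sum_(L in legal_sets e c) F L).
  by rewrite (big_nth [::]) big_mkord.
rewrite (exchange_big_dep (legal e)) => [|c L _]; last first.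
  by rewrite inE => /andP[].
rewrite [RHS]big_mkcondr; apply: eq_bigr => L Ll.
set lv := [seq leaves s | s <- enum L].
have kE : #|star_labels a L| = sumn lv.
  by apply: (@card_star_labels _ e) => //; rewrite inE Ll perm_refl.
have lv2 : all (fun x => 1 < x)%N lv.
  apply/allP => x /mapP[s sL ->]; rewrite mem_enum in sL.
  by case/andP: Ll => /forall_inP/(_ s sL)/and3P[].
have geq_total : total geq by move=> x y; apply: leq_total.
have geq_trans : transitive geq by move=> x y z yx zy; apply: leq_trans zy yx.
have geq_anti : antisymmetric geq.
  by move=> x y; rewrite andbC => /anti_leq.
have sort_c c : c \in unique_partitions k ->
    (L \in legal_sets e c) = (c == sort geq lv).
  rewrite mem_unique_partitions inE Ll /= => /and3P[cs _ _].
  apply/idP/eqP => [lc|->]; last by rewrite perm_sym perm_sort.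
  apply: (sorted_eq geq_trans geq_anti) => //; first exact: sort_sorted.
  by rewrite perm_sym perm_sort.
have sort_mem : (sort geq lv \in unique_partitions k) = (sumn lv == k).
  rewrite mem_unique_partitions /unique_partition sort_sorted // all_sort lv2.
  by rewrite (perm_sumn (s2 := lv)) ?perm_sort.
rewrite big_seq_cond; under eq_bigl => c do rewrite (andb_id2l (@sort_c c)).
rewrite -big_seq_cond kE -sort_mem; case: ifPn => sk.
  rewrite -big_filter (filter_pred1_uniq (uniq_unique_partitions k) sk).
  by rewrite big_seq1.
by apply: big1_seq => c /andP[/eqP-> sk']; rewrite sk' in sk.
Qed.

(** * The coefficient formula *)

(** Only the label sets without a lone arc into a vertex contribute to the sum
    of minors, and these are reindexed by legal sets of stars. *)
Lemma sum_prototypes_minors k (P : 'I_(num_unique_partitions k) -> 'M[int]_k) :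
  (forall i, legal_sets e (rho i) != set0 -> prototype e a (rho i) (P i)) ->
  \sum_(i < num_unique_partitions k)
    #|legal_sets e (rho i)|%:R * \det (P i) =
  \sum_(S : {set 'I_(m + m)} | #|S| == k)
    \det (principal_submx same_head_mx S).
Proof.
move=> P_proto.
rewrite [RHS](bigID singleton_free) /= [X in _ = _ + X]big1 ?addr0; last first.
  by move=> S /andP[_]; apply: det_same_head_minor_eq0.
rewrite (reindex_onto (star_labels a) stars_of) /= => [|S _]; last first.
  exact: star_labelsK.
rewrite (eq_bigl (fun L => legal e L && (#|star_labels a L| == k))); last first.
  move=> L; apply/andP/andP => [[/andP[Lk /stars_of_legal]]|[Ll Lk]].
    by move=> Ll /eqP LK; rewrite LK in Ll.
  by rewrite Lk star_labels_singleton_free // stars_ofK.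
rewrite -sum_legal_sets; apply: eq_bigr => i _.
rewrite mulr_natl -sumr_const; apply: eq_bigr => L Li; apply/esym.
by apply: (det_prototype _ Li); apply: P_proto; apply/set0Pn; exists L.
Qed.

End Bartholdi.

Theorem theorem5p7 (V : finType) (e : rel V)
  (e_sym : symmetric e) (e_irr : irreflexive e)
  (deg_ge2 : forall x : V, (2 <= degree e x)%N)
  (m : nat) (card_edges : #|edges e| = m)
  (a : 'I_m -> V * V) (a_orient : orientation e a)
  (k : nat) (k_gt0 : (1 <= k)%N) (k_le : (k <= 2 * m)%N)
  (P : 'I_(num_unique_partitions k) -> 'M[int]_k)
  (P_proto : forall i, legal_sets e (rho i) != set0 -> prototype e a (rho i) (P i)) :
  (reduced_bartholdi a)`_(2 * m - k) =
    (-1) ^+ m * \sum_(i < num_unique_partitions k)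
                   #|legal_sets e (rho i)|%:R * \det (P i).
Proof.
move: k_le; rewrite mul2n -addnn => k_le.
rewrite (reduced_bartholdiE e_irr a_orient).
rewrite (sum_prototypes_minors e_sym e_irr a_orient P_proto).
by rewrite -(coef_det_addX_minors _ k_le) -(rmorph_sign polyC) coefCM.
Qed.
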